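(* Let $n, k, s, \ell$ be positive integers with $n = sk+\ell$, $1 \le \ell \le k$ and $s \ge 4\ell$. Suppose that $\mathcal{F}_0, \mathcal{F}_1, \ldots, \mathcal{F}_s \subset \binom{[n]}{k}$ are non-empty and cross-union. Then $$\frac{|\mathcal{F}_0| + |\mathcal{F}_1| + \cdots + |\mathcal{F}_s|}{s+1} \le \binom{n-1}{k}.$$ Furthermore, equality is attained only if $\mathcal{F}_0 = \cdots = \mathcal{F}_s = \binom{[n]\setminus\{i\}}{k}$ for some $i \in [n]$.
   Context: Here $[n] = \{1, 2, \ldots, n\}$, and for a set $X$, $\binom{X}{k}$ denotes the family of all $k$-element subsets of $X$. Families $\mathcal{F}_0, \ldots, \mathcal{F}_s$ of subsets of $[n]$ are called cross-union if there is no choice of $F_0 \in \mathcal{F}_0, \ldots, F_s \in \mathcal{F}_s$ with $F_0 \cup F_1 \cup \cdots \cup F_s = [n]$. ''Non-empty'' means that each family $\mathcal{F}_i$ contains at least one set. The symbol $\subset$ allows equality. *)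

(* Defs.v *)
From mathcomp Require Import all_boot all_order all_algebra.

Set Implicit Arguments.
Unset Strict Implicit.
Unset Printing Implicit Defensive.

Definition ksubsets (T : finType) (X : {set T}) (k : nat) : {set {set T}} :=
  [set A : {set T} | A \subset X & #|A| == k].

Definition cross_union (T I : finType) (F : I -> {set {set T}}) : Prop :=
  ~ exists G : I -> {set T},
      (forall i, G i \in F i) /\ \bigcup_i G i = [set: T].

(* Main.v *)
Require Import Defs.
From mathcomp Require Import all_boot all_order all_algebra fingroup perm.
From mathcomp Require Import zify ring lra.
Import Order.TTheory GRing.Theory Num.Theory.
Local Open Scope nat_scope.

(** Let [q i] be the proportion of [k]-sets missing from [F i], let [lam i] be the
    proportion of [l]-sets contained in no member of [F i], and let [Q] be the sum
    of the [q i]. The claim is [Q >= (s + 1) k / n = 1 + (k - l) / n]. It combines a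
    covering argument with an expansion property of the subset lattice.

    Covering. Let an [l]-set [L] be contained in a member of [F i]. Every partition
    of the complement of [L] into [s] [k]-sets, dealt out to the other families,
    has a block missing from its family, because the blocks and that member
    cover everything ([cross_union_missing_off]). Averaging over the partitions
    and over all such [L] yields [Q - q i >= 1 - lam i]. Since [F i] is not empty,
    averaging over the partitions alone for a single [L] yields
    [Q - q i >= 'C(n - l, k) / 'C(n, k)], a number close to 1 when [s] is large
    compared to [l].

    Expansion. No member of [F i] contains an uncovered [l]-set, so [lam i] is small
    in terms of [q i]: if an upset has density [d] at level [j], the ratio
    [d / (1 - d) * (n - j) / j] never decreases with [j] ([normalized_odds_le]). It is
    constantly 1 for the sets through a fixed point, which is why the resulting bound
    is sharp. One step of this ([shadow_odds]) is a flow argument. A [j]-set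
    and a [j + 1]-set are joined by a path that exchanges their elements one by
    one; if it starts outside the upset and ends inside, then it enters the
    upset along one of its upward edges, and by symmetry under permutations
    all edges are equally likely to serve.

    Eliminating the [lam i] from these inequalities is elementary
    ([deficiency_bound]). In the equality case the uncovered [l]-sets are the same for
    all families, intersect pairwise and have density [l / n]. Applying
    the expansion property between levels [l] and [n - l] shows that they are
    all the [l]-sets through some point ([intersecting_max_star]), and this point
    then belongs to no member of any family ([cross_union_extremal]). *)

(** * Averaging over permutations *)

(** List each pair followed by the rest of [T]; the permutation matching the two
    lists position by position does the job. *)
Lemma perm_pair_trans (T : finType) (A B A' B' : {set T}) :
  [disjoint A & B] -> [disjoint A' & B'] -> #|A| = #|A'| -> #|B| = #|B'| ->
  exists p : {perm T}, p @: A = A' /\ p @: B = B'.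
Proof.
move=> dAB dAB' cA cB.
pose lst (X Y : {set T}) := enum X ++ enum Y ++ enum (~: (X :|: Y)).
have lst_enum (X Y : {set T}) : [disjoint X & Y] -> perm_eq (lst X Y) (enum T).
  move=> dXY; apply: uniq_perm; first last.
  - move=> x; rewrite !mem_cat !mem_enum !inE.
    by case: (x \in X); case: (x \in Y).
  - exact: enum_uniq.
  - rewrite !cat_uniq !enum_uniq /= andbT; apply/andP; split.
      apply/hasPn => x; rewrite mem_cat !mem_enum !inE => /orP[xY|].
        by apply: contraL xY => xX; rewrite (disjointFr dXY xX).
      by rewrite negb_or => /andP[].
    by apply/hasPn => x; rewrite !mem_enum !inE negb_or => /andP[].
have sz (X Y : {set T}) : [disjoint X & Y] -> size (lst X Y) = #|T|.
  by move=> /lst_enum/perm_size; rewrite -cardE.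
have mem_lst x : x \in lst A B.
  by rewrite (perm_mem (lst_enum _ _ dAB)) mem_enum.
pose f x := nth x (lst A' B') (index x (lst A B)).
have idx x : index x (lst A B) < size (lst A' B').
  by rewrite sz // -(sz A B) // index_mem.
have f_inj : injective f.
  move=> x y; rewrite /f (set_nth_default x) // => /eqP.
  rewrite nth_uniq ?idx //; last first.
    by rewrite (perm_uniq (lst_enum _ _ dAB')) enum_uniq.
  by move=> /eqP /(congr1 (nth x (lst A B))); rewrite !nth_index.
exists (perm f_inj); split; apply/eqP; rewrite eqEcard card_imset ?cA ?cB ?leqnn ?andbT;
  try exact: perm_inj; apply/subsetP => _ /imsetP[x xX ->]; rewrite permE /f.
- rewrite index_cat mem_enum xX nth_cat -cardE -cA cardE index_mem mem_enum xX.
  by rewrite -mem_enum mem_nth // -cardE -cA cardE index_mem mem_enum.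
- rewrite !index_cat !mem_enum xX (disjointFl dAB xX) nth_cat -!cardE -cA ltnNge leq_addr /=.
  rewrite addKn nth_cat -cardE -cB cardE index_mem mem_enum xX.
  by rewrite -mem_enum mem_nth // -cardE -cB cardE index_mem mem_enum.
Qed.

Lemma imset_permM (T : finType) (p q : {perm T}) (A : {set T}) :
  (p * q)%g @: A = q @: (p @: A).
Proof. by rewrite -imset_comp; apply: eq_imset => x /=; rewrite permM. Qed.

Lemma imset_perm1 (T : finType) (A : {set T}) : (1 : {perm T})%g @: A = A.
Proof. by rewrite (eq_imset (g := id)) ?imset_id // => x; rewrite perm1. Qed.

(** Transitivity makes every pair of disjoint sets of the right sizes the image of
    [(A, B)] under equally many permutations, so the average of [f] over the
    images equals its plain average over such pairs. *)
Lemma perm_pair_average (T : finType) (A B : {set T}) (f : {set T} -> {set T} -> nat) :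
  [disjoint A & B] ->
  'C(#|T|, #|A|) * 'C(#|T| - #|A|, #|B|)
    * (\sum_(p : {perm T}) f (p @: A) (p @: B))
  = #|T|`! * \sum_(X : {set T} | #|X| == #|A|)
               \sum_(Y : {set T} | (#|Y| == #|B|) && [disjoint X & Y]) f X Y.
Proof.
move=> dAB.
pose good (u : {set T} * {set T}) :=
  (#|u.1| == #|A|) && ((#|u.2| == #|B|) && [disjoint u.1 & u.2]).
pose c := #|[set p : {perm T} | (p @: A == A) && (p @: B == B)]|.
have perm_good (p : {perm T}) : good (p @: A, p @: B).
  rewrite /good /= !card_imset ?eqxx /=; try exact: perm_inj.
  by rewrite imset_disjoint //; exact: perm_inj.
have cE u : good u -> #|[set p : {perm T} | (p @: A, p @: B) == u]| = c.
  case: u => X Y /= /and3P[/= /eqP cX /eqP cY dXY].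
  have [r [rA rB]] := @perm_pair_trans T _ _ _ _ dAB dXY (esym cX) (esym cY).
  rewrite /c -(card_imset (mem [set p : {perm T} | (p @: A == A) && (p @: B == B)])
     (@mulIg _ r)).
  congr #|pred_of_set _|; apply/setP=> p; rewrite inE xpair_eqE; apply/idP/imsetP.
  - case/andP=> /eqP pA /eqP pB; exists (p * r^-1)%g; last by rewrite mulgKV.
    by rewrite inE !imset_permM pA pB -rA -rB -!imset_permM mulgV !imset_perm1 !eqxx.
  - case=> q; rewrite inE => /andP[/eqP qA /eqP qB] ->.
    by rewrite !imset_permM qA qB rA rB !eqxx.
have avg (g : {set T} -> {set T} -> nat) :
    \sum_(p : {perm T}) g (p @: A) (p @: B) = c * \sum_(u | good u) g u.1 u.2.
  rewrite (partition_big (fun p : {perm T} => (p @: A, p @: B)) good) /=; last by [].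
  rewrite big_distrr; apply: eq_bigr => u gu.
  rewrite -(cE u gu) -sum1_card big_distrl /=.
  by apply: eq_big => [p|p /eqP <-]; rewrite ?inE ?mul1n.
have := avg (fun _ _ => 1); rewrite sum1_card.
have -> : #|{perm T}| = #|T|`!.
  rewrite -[X in X`!]cardsT -card_perm; apply: eq_card => p.
  by rewrite inE; symmetry; apply/subsetP => x; rewrite inE.
move=> ->; rewrite avg.
have goodE (g : {set T} -> {set T} -> nat) : \sum_(u | good u) g u.1 u.2 =
   \sum_(X : {set T} | #|X| == #|A|)
               \sum_(Y : {set T} | (#|Y| == #|B|) && [disjoint X & Y]) g X Y.
  by rewrite pair_big_dep.
rewrite (goodE f) (goodE (fun _ _ => 1)).
have -> : \sum_(X : {set T} | #|X| == #|A|)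
     \sum_(Y : {set T} | (#|Y| == #|B|) && [disjoint X & Y]) 1
   = 'C(#|T|, #|A|) * 'C(#|T| - #|A|, #|B|).
  rewrite (eq_bigr (fun _ => 'C(#|T| - #|A|, #|B|))) => [|X /eqP cX]; last first.
    rewrite sum1dep_card -cX (cardsCs X) subKn ?max_card //.
    rewrite -(cards_draws (~: X) #|B|).
    by apply: eq_card => Y; rewrite !inE disjoint_sym disjoints_subset andbC.
  rewrite sum_nat_const; congr (_ * _).
  by rewrite -card_draws; apply: eq_card => X; rewrite inE.
by rewrite mulnCA -[RHS]mulnA.
Qed.

Lemma perm_average (T : finType) (A : {set T}) (f : {set T} -> nat) :
  'C(#|T|, #|A|) * (\sum_(p : {perm T}) f (p @: A))
  = #|T|`! * \sum_(X : {set T} | #|X| == #|A|) f X.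
Proof.
have d0 (X : {set T}) : [disjoint X & set0] by rewrite disjoints_subset setC0 subsetT.
have := perm_pair_average _ A set0 (fun X _ => f X) (d0 A).
rewrite cards0 bin0 muln1 => ->; congr (_ * _); apply: eq_bigr => X _.
rewrite (bigD1 set0) /= ?cards0 ?d0 // big1 ?addn0 // => Y.
by case/andP=> /andP[/eqP/cards0_eq-> _]; rewrite eqxx.
Qed.

Lemma perm_average_mem (T : finType) (A : {set T}) (X : {set {set T}}) :
  X \subset ksubsets [set: T] #|A| ->
  'C(#|T|, #|A|) * #|[set p : {perm T} | p @: A \in X]| = #|T|`! * #|X|.
Proof.
move=> sX.
have -> : #|[set p : {perm T} | p @: A \in X]| = \sum_(p : {perm T}) (p @: A \in X).
  by rewrite -sum1dep_card big_mkcond; apply: eq_bigr => p _; case: (_ \in X).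
rewrite (perm_average _ A (fun B => B \in X)) -big_mkcondr sum1dep_card.
congr (_ * _); apply: eq_card => B; rewrite inE.
apply/andP/idP=> [[]//|BX]; split=> //.
by have := subsetP sX _ BX; rewrite inE => /andP[].
Qed.

(** * Partitions that avoid an l-set *)

Lemma card_ord_interval (n a k : nat) :
  a + k <= n -> #|[set x : 'I_n | a <= x < a + k]| = k.
Proof.
move=> le_ak_n.
have lt_n (i : 'I_k) : a + i < n by have := ltn_ord i; lia.
pose f (i : 'I_k) := Ordinal (lt_n i).
have f_inj : injective f by move=> i j [/addnI /val_inj].
rewrite -[RHS]card_ord -cardsT -(card_imset _ f_inj); apply: eq_card => x.
rewrite inE; apply/idP/imsetP => [/andP[ax xa]|[i _ ->]]; last first.
  by rewrite /= leq_addr ltn_add2l ltn_ord.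
have ik : x - a < k by lia.
by exists (Ordinal ik) => //; apply: val_inj; rewrite /= subnKC.
Qed.

Definition missing_off {T : finType} (F : {set {set T}}) (k : nat) (L : {set T}) :=
  [set B : {set T} | (#|B| == k) && [disjoint L & B] & B \notin F].

(** The union of the blocks of a partition of the complement of [L] into [s]
    [k]-sets together with [A] is everything, so if the blocks are dealt out to
    the families other than [F i0], some block misses its family. Averaging this
    over all images of one fixed partition turns it into a count of missing
    [k]-sets. *)
Lemma cross_union_missing_off {n k s l : nat} {F : 'I_s.+1 -> {set {set 'I_n}}}
    {i0 : 'I_s.+1} {A L : {set 'I_n}} :
  n = s * k + l -> cross_union F -> A \in F i0 -> L \subset A -> #|L| = l ->
  'C(n - l, k) <= \sum_(i | i != i0) #|missing_off (F i) k L|.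
Proof.
move=> n_eq crossF AF LA cL.
(* A template: the first l points, then s consecutive blocks of k points. *)
pose t0 := [set x : 'I_n | 0 <= x < 0 + l].
pose t (j : 'I_s) := [set x : 'I_n | l + j * k <= x < l + j * k + k].
have ct0 : #|t0| = l by rewrite card_ord_interval //; lia.
have ct j : #|t j| = k.
  by rewrite card_ord_interval //; have := ltn_ord j; nia.
have dt j : [disjoint t0 & t j].
  by rewrite disjoints_subset; apply/subsetP => x; rewrite !inE; lia.
pose bad j (X Y : {set 'I_n}) := (X == L) && (Y \notin F (lift i0 j)).
have cover (p : {perm 'I_n}) : p @: t0 = L -> exists j, p @: t j \notin F (lift i0 j).
  move=> pL; case: (boolP [exists j, p @: t j \notin F (lift i0 j)]) => [/existsP //|].
  rewrite negb_exists => /forallP allF.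
  case: crossF; exists (fun i => if unlift i0 i is Some j then p @: t j else A).
  split=> [i|].
    by case: unliftP => [j ->|->] //; have := allF j; rewrite negbK.
  apply/setP=> y; rewrite inE; apply/bigcupP.
  pose x := (p^-1)%g y; have yE : y = p x by rewrite permKV.
  have [xl|lx] := ltnP x l.
    exists i0 => //; rewrite unlift_none; apply: (subsetP LA).
    by rewrite -pL yE imset_f // inE /=.
  have k_gt0 : 0 < k.
    by case: (k) n_eq lx => // ne; have := ltn_ord x; lia.
  have xs : (x - l) %/ k < s.
    by rewrite ltn_divLR //; have := ltn_ord x; lia.
  exists (lift i0 (Ordinal xs)) => //; rewrite liftK yE imset_f // inE /=.
  have := divn_eq (x - l) k; have := ltn_pmod (x - l) k_gt0; lia.
have avg0 : 'C(n, l) * \sum_(p : {perm 'I_n}) (p @: t0 == L) = n`!.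
  have := perm_average _ t0 (fun X => X == L); rewrite ct0 card_ord => ->.
  by rewrite (bigD1 L) ?cL //= eqxx big1 ?muln1 // => X /andP[_ /negPf->].
have avg j : 'C(n, l) * 'C(n - l, k) * \sum_(p : {perm 'I_n}) bad j (p @: t0) (p @: t j)
   = n`! * #|missing_off (F (lift i0 j)) k L|.
  have := @perm_pair_average _ t0 (t j) (fun X Y => bad j X Y) (dt j).
  rewrite ct0 ct card_ord => ->; congr (_ * _).
  rewrite (bigD1 L) ?cL //= [X in _ + X]big1 ?addn0 => [|X /andP[_ /negPf XL]]; last first.
    by rewrite big1 // => Y _; rewrite /bad XL.
  rewrite /missing_off -sum1dep_card [RHS]big_mkcondr /=.
  by apply: eq_bigr => Y _; rewrite /bad eqxx; case: (_ \in _).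
have sum_bad : \sum_(p : {perm 'I_n}) (p @: t0 == L)
    <= \sum_j \sum_(p : {perm 'I_n}) bad j (p @: t0) (p @: t j).
  rewrite exchange_big /=; apply: leq_sum => p _.
  case: eqP => // /[dup] pL /cover[j jF].
  by rewrite (bigD1 j) //= /bad pL eqxx jF.
have lift_sum (G : 'I_s.+1 -> nat) : \sum_(i | i != i0) G i = \sum_j G (lift i0 j).
  have /eqP := @bigD1_ord _ addn 0 _ i0 predT G erefl.
  by rewrite (bigD1 i0) //= eqn_add2l => /eqP.
rewrite lift_sum -(leq_pmul2l (fact_gt0 n)) big_distrr /=.
under eq_bigr do rewrite -avg.
by rewrite -big_distrr /= -avg0 mulnAC leq_mul2l sum_bad orbT.
Qed.

(** * Expansion from one level to the next *)

(** For [A] below [B] the permutations counted carry the edge from [A] to [B] to one that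
    leaves the complement of [X] upwards; other pairs are compared to edges. *)
Definition crossings {T : finType} (X Y : {set {set T}}) (A B : {set T}) :=
  #|[set p : {perm T} | (p @: A \notin X) && (p @: B \in Y)]|.

Definition up_closed {T : finType} (X Y : {set {set T}}) :=
  forall A x, A \in X -> x \notin A -> x |: A \in Y.

(** The path from [A] to [B] through [y |: A] and [(y |: A) :\ x] can only go from
    outside [X] to inside [Y] by doing so on one of its two halves: if
    [y |: A] is not in [Y], then nothing below it is in [X]. *)
Lemma crossings_step {T : finType} {X Y : {set {set T}}} {A B : {set T}} {x y : T} :
  up_closed X Y -> x \in A -> y \notin A ->
  crossings X Y A B <= crossings X Y A (y |: A) + crossings X Y ((y |: A) :\ x) B.
Proof.
move=> upXY xA yA; rewrite -cardsUI; apply: leq_trans (leq_addr _ _).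
apply/subset_leq_card/subsetP => p; rewrite !inE => /andP[-> ->] /=.
rewrite andbT orbC; case: (boolP (_ \in X)) => //= /(upXY _ (p x)).
rewrite -imsetU1 setD1K ?inE ?xA ?orbT //; apply.
by rewrite mem_imset ?inE ?eqxx //; exact: perm_inj.
Qed.

Lemma cardsC_ksubsets (T : finType) (X : {set {set T}}) j :
  X \subset ksubsets [set: T] j -> #|X| + #|ksubsets [set: T] j :\: X| = 'C(#|T|, j).
Proof.
move=> sX; rewrite -cardsT -cards_draws -(cardsID X (ksubsets [set: T] j)).
by rewrite (setIidPr sX).
Qed.

Section OneStep.
Context {T : finType} {X Y : {set {set T}}} {j : nat}.
Hypothesis sX : X \subset ksubsets [set: T] j.
Hypothesis sY : Y \subset ksubsets [set: T] j.+1.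
Hypothesis upXY : up_closed X Y.
Hypothesis j_lt : j < #|T|.
Let n := #|T|.
Let cX := ksubsets [set: T] j :\: X.

(** For an edge, upward closure makes the number of crossings the difference of
    two one-set counts, so it is the same for all edges. *)
Lemma crossings_edge (A : {set T}) x : #|A| = j -> x \notin A ->
  'C(n, j) * (n - j) * crossings X Y A (x |: A) + n`! * ((n - j) * #|X|)
  = n`! * (j.+1 * #|Y|).
Proof.
move=> cA xA.
have cB : #|x |: A| = j.+1 by rewrite cardsU1 xA cA.
have -> : n`! * ((n - j) * #|X|) = 'C(n, j) * (n - j) * #|[set p : {perm T} | p @: A \in X]|.
  by rewrite mulnAC -cA perm_average_mem ?cA // mulnAC mulnA.
have -> : n`! * (j.+1 * #|Y|)
    = 'C(n, j) * (n - j) * #|[set p : {perm T} | p @: (x |: A) \in Y]|.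
  rewrite [_ * (n - j)]mulnC -mul_bin_left -cB -mulnA perm_average_mem ?cB //.
  by rewrite mulnCA.
rewrite -mulnDr; congr (_ * _); rewrite addnC -cardsUI.
rewrite [X in _ + X](_ : _ = 0) ?addn0; last first.
  by apply: eq_card0 => p; rewrite !inE; case: (_ \in X).
apply: eq_card => p; rewrite !inE; case: (boolP (_ \in X)) => //= pA.
by rewrite imsetU1; symmetry; apply: upXY; rewrite // mem_imset //; exact: perm_inj.
Qed.

(** Exchanging one element at a time, [A] is joined to [B] by a path with
    [1 + #|A :\: B|] upward edges, all of which have equally many crossings;
    [n`! * E] is that number, suitably normalised. *)
Lemma crossings_le (E : nat) : E + (n - j) * #|X| = j.+1 * #|Y| ->
  forall A B : {set T}, #|A| = j -> #|B| = j.+1 ->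
  'C(n, j) * (n - j) * crossings X Y A B <= (1 + #|A :\: B|) * (n`! * E).
Proof.
move=> defE.
have edge (A : {set T}) x : #|A| = j -> x \notin A ->
    'C(n, j) * (n - j) * crossings X Y A (x |: A) = n`! * E.
  move=> cA xA; apply/eqP; rewrite -(eqn_add2r (n`! * ((n - j) * #|X|))).
  by rewrite crossings_edge // -mulnDr defE.
move=> A B; have [r] := ubnP #|A :\: B|; elim: r A => // r IHr A + cA cB.
have [dAB|[x]] := set_0Vmem (A :\: B).
  move=> _; rewrite dAB cards0 mul1n.
  have sAB : A \subset B by rewrite -setD_eq0 dAB.
  have /cards1P[x Bx] : #|B :\: A| == 1.
    by rewrite cardsD (setIidPr sAB) cA cB subSnn.
  have xBA : x \in B :\: A by rewrite Bx inE.
  have <- : x |: A = B by rewrite -Bx setUC setDE setUIr setUCr setIT (setUidPr sAB).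
  by rewrite edge //; move: xBA; rewrite inE => /andP[].
rewrite inE => /andP[xB xA] dr.
have /set0Pn[y] : B :\: A != set0.
  rewrite setD_eq0; apply: contraTN (leqnn j) => /subset_leq_card.
  by rewrite cA cB ltnn.
rewrite inE => /andP[yA yB].
have dA' : (y |: A) :\ x :\: B = (A :\: B) :\ x.
  apply/setP=> z; rewrite !inE [RHS]andbCA.
  by case: (eqVneq z y) => [->|] //=; rewrite yB.
have cdA : #|A :\: B| = (#|(A :\: B) :\ x|).+1.
  by rewrite (cardsD1 x (A :\: B)) inE xB xA.
have cA' : #|(y |: A) :\ x| = j.
  by have := cardsD1 x (y |: A); rewrite cardsU1 yA cA !inE xA orbT => -[].
apply: leq_trans (leq_mul (leqnn _) (crossings_step upXY xA yA)) _.
rewrite mulnDr edge // mulnDl mul1n leq_add2l.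
rewrite (leq_trans (IHr _ _ cA' cB)) ?dA' ?cdA ?add1n //.
by move: dr; rewrite cdA.
Qed.

Lemma sum_crossings (A : {set T}) : #|A| = j ->
  'C(n, j) * \sum_(B : {set T} | #|B| == j.+1) crossings X Y A B = n`! * #|cX| * #|Y|.
Proof.
move=> cA.
have -> : n`! * #|cX| = 'C(n, j) * #|[set p : {perm T} | p @: A \in cX]|.
  by rewrite -cA perm_average_mem ?cA // subsetDl.
rewrite -mulnA; congr (_ * _).
transitivity (\sum_(p : {perm T} | p @: A \in cX)
    \sum_(B : {set T} | #|B| == j.+1) (p @: B \in Y : nat)).
  under eq_bigr do rewrite /crossings -sum1dep_card big_mkcond /=.
  rewrite exchange_big /= [RHS]big_mkcond /=; apply: eq_bigr => p _.
  have -> : (p @: A \in cX) = (p @: A \notin X).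
    by rewrite !inE subsetT card_imset ?cA ?eqxx ?andbT //; exact: perm_inj.
  case: ifP => pA; last by rewrite big1.
  by apply: eq_bigr => B _; case: (_ \in Y).
rewrite -sum_nat_const; apply: eq_big => [p|p _]; first by rewrite inE.
rewrite -big_mkcondr sum1dep_card -(card_imset Y (f := fun B : {set T} => (p^-1)%g @: B)).
  apply: eq_card => B; rewrite inE; apply/idP/imsetP=> [/andP[_ BY]|[C CY ->]].
    by exists (p @: B) => //; rewrite -imset_permM mulgV imset_perm1.
  rewrite -imset_permM mulVg imset_perm1 CY card_imset ?andbT; last exact: perm_inj.
  by have := subsetP sY _ CY; rewrite inE => /andP[].
by apply: imset_inj; exact: perm_inj.
Qed.

Lemma sum_cardsD (A : {set T}) : #|A| = j ->
  \sum_(B : {set T} | #|B| == j.+1) (1 + #|A :\: B|)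
  = 'C(n, j.+1) + j * 'C(n.-1, j.+1).
Proof.
move=> cA; rewrite big_split /= sum1dep_card card_draws; congr (_ + _).
under eq_bigr do rewrite -sum1_card.
rewrite (exchange_big_dep (mem A)) => [|B x _]; last by rewrite inE => /andP[].
rewrite -{2}cA -sum_nat_const; apply: eq_bigr => x xA.
rewrite sum1dep_card -(cardsC1 x) -cards_draws; apply: eq_card => B.
by rewrite !inE subsetC sub1set inE (xA : x \in A) andbT andbC.
Qed.

(** Summing the two sides of [crossings_le] over [B]: the left side becomes the
    product of the sizes of the complement of [X] and of [Y], as if [A] and [B]
    were independent, and the right side only needs the mean of [#|A :\: B|]. *)
Lemma crossings_total (A : {set T}) (E : nat) : #|A| = j ->
  E + (n - j) * #|X| = j.+1 * #|Y| ->
  n * \sum_(B : {set T} | #|B| == j.+1) 'C(n, j) * (n - j) * crossings X Y A B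
     = n`! * (n - j) * (n * #|cX| * #|Y|)
  /\ n * \sum_(B : {set T} | #|B| == j.+1) (1 + #|A :\: B|) * (n`! * E)
     = n`! * (n - j) * (E * ('C(n, j) * (n - j))).
Proof.
move=> cA defE; split.
  rewrite -big_distrr /= mulnAC sum_crossings //; ring.
rewrite -big_distrl /= sum_cardsD //.
have nE : n * ('C(n, j.+1) + j * 'C(n.-1, j.+1)) = (n - j) * ('C(n, j) * (n - j)).
  have := mul_bin_left n j; have := mul_bin_left n j.+1; have := mul_bin_diag n j.
  have := mul_bin_diag n j.+1; have := mul_bin_left n.-1 j.
  have nj : n = j + (n - j) by rewrite subnKC // ltnW.
  have nj1 : n.-1 - j = (n - j).-1 by lia.
  have nj2 : n - j.+1 = (n - j).-1 by lia.
  rewrite nj1 nj2.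
  have : 0 < n - j by rewrite subn_gt0.
  case: (n - j) nj => // u nu _ /=; rewrite nu => h1 h2 h3 h4 h5.
  have h6 : (j + u.+1) * 'C((j + u.+1).-1, j.+1) = u * 'C(j + u.+1, j.+1).
    by apply/eqP; rewrite -(eqn_pmul2l (ltn0Sn j)); apply/eqP; nia.
  nia.
by rewrite mulnA nE; ring.
Qed.

Lemma one_step_slack (E a b c d m u : nat) :
  E + u.+1 * a = m.+1 * b -> (b + d) * m.+1 = (a + c) * u.+1 ->
  a * u.+1 * d * m.+1 + E * ((a + c) * u.+1) = b * u * c * m + (m + u.+1) * c * b.
Proof.
move=> h1 h2.
have := congr1 (muln (a * u.+1)) h2; have := congr1 (muln ((a + c) * u.+1)) h1; nia.
Qed.

(** [E] counts the edges from the complement of [X] to [Y]. The second identity shows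
    that [shadow_odds] amounts to the upper bound on [n * #|cX| * #|Y|] that
    [crossings_le] and [crossings_total] give. *)
Lemma shadow_double_count : exists2 E, E + (n - j) * #|X| = j.+1 * #|Y|
  & #|X| * (n - j) * #|ksubsets [set: T] j.+1 :\: Y| * j.+1 + E * ('C(n, j) * (n - j))
    = #|Y| * (n - j.+1) * #|cX| * j + n * #|cX| * #|Y|.
Proof.
have /card_gt0P[A] : 0 < #|[set A : {set T} | #|A| == j]|.
  by rewrite card_draws bin_gt0 ltnW.
rewrite inE => /eqP cA.
have /card_gt0P[x] : 0 < #|~: A| by rewrite cardsCs setCK cA subn_gt0.
rewrite inE => xA.
have le : (n - j) * #|X| <= j.+1 * #|Y|.
  by rewrite -(leq_pmul2l (fact_gt0 n)) -(crossings_edge A x cA xA) leq_addl.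
exists (j.+1 * #|Y| - (n - j) * #|X|); first by rewrite subnK.
have cXE := cardsC_ksubsets _ _ _ sX; have cYE := cardsC_ksubsets _ _ _ sY.
have := mul_bin_left n j; rewrite -/n -/cX in cXE cYE *; rewrite -cXE -cYE.
have -> : n - j.+1 = (n - j).-1 by lia.
have nj : n = j + (n - j) by rewrite subnKC // ltnW.
have : 0 < n - j by rewrite subn_gt0.
case: (n - j) nj le => // u -> le _ /= binE.
by apply: one_step_slack; [rewrite subnK | rewrite mulnC binE mulnC].
Qed.

(** With [lam] and [q] the densities of [X] and [Y], this is
    [lam / (1 - lam) * ((n - j) / j) <= q / (1 - q) * ((n - j.+1) / j.+1)],
    an equality when [X] and [Y] consist of all sets through one point. Equality
    in the sum forces equality for every pair [A], [B]. *)
Lemma shadow_odds :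
  #|X| * (n - j) * (#|ksubsets [set: T] j.+1 :\: Y| * j.+1)
  <= #|Y| * (n - j.+1) * (#|cX| * j) ?= iff
     [forall A : {set T}, forall B : {set T}, (#|A| == j) && (#|B| == j.+1) ==>
       ('C(n, j) * (n - j) * crossings X Y A B ==
        (1 + #|A :\: B|) * (n`! * (j.+1 * #|Y| - (n - j) * #|X|)))].
Proof.
have [E defE slack] := shadow_double_count.
have -> : j.+1 * #|Y| - (n - j) * #|X| = E by rewrite -defE addnK.
have n_gt0 : 0 < n by apply: leq_ltn_trans j_lt.
have u_gt0 : 0 < n - j by rewrite subn_gt0.
have tot_gt0 : 0 < n`! * (n - j) by rewrite muln_gt0 fact_gt0.
have total (A : {set T}) : #|A| = j ->
    n * #|cX| * #|Y| <= E * ('C(n, j) * (n - j)) ?= iff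
      [forall B : {set T}, (#|B| == j.+1) ==>
       ('C(n, j) * (n - j) * crossings X Y A B == (1 + #|A :\: B|) * (n`! * E))].
  move=> cA; have [t1 t2] := crossings_total _ _ cA defE.
  have [le eq] := @leqif_sum _ (fun B : {set T} => #|B| == j.+1) _ _ _
    (fun B cB => leqif_eq (crossings_le _ defE A B cA (eqP cB))).
  split; first by rewrite -(leq_pmul2l tot_gt0) -t1 -t2 leq_mul2l le orbT.
  by rewrite -(eqn_pmul2l tot_gt0) -t1 -t2 eqn_pmul2l.
have /card_gt0P[A0] : 0 < #|[set A : {set T} | #|A| == j]|.
  by rewrite card_draws bin_gt0 ltnW.
rewrite inE => /eqP cA0.
split.
  by have := (total _ cA0).1; lia.
rewrite !mulnA; transitivity (n * #|cX| * #|Y| == E * ('C(n, j) * (n - j))).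
  by apply/eqP/eqP; lia.
apply/idP/forallP => [tE A|allE].
  apply/forallP => B; apply/implyP => /andP[/eqP cA cB].
  by move: tE; rewrite (total _ cA).2 => /forallP/(_ B)/implyP/(_ cB).
rewrite (total _ cA0).2; apply/forallP => B; apply/implyP => cB.
by have /forallP/(_ B)/implyP := allE A0; apply; rewrite cA0 eqxx.
Qed.

(** In the equality case the path bound is attained, also pointwise: along a path
    of two edges the crossings of the two halves are exclusive, and each of
    them makes the whole path a crossing. *)
Lemma shadow_odds_exchange (A : {set T}) (x y z : T) :
  #|X| * (n - j) * (#|ksubsets [set: T] j.+1 :\: Y| * j.+1)
    = #|Y| * (n - j.+1) * (#|cX| * j) ->
  #|A| = j -> x \in A -> y \notin A -> z \notin y |: A ->
  ((A \notin X) && (z |: ((y |: A) :\ x) \in Y) : nat)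
  = ((A \notin X) && (y |: A \in Y)) + (((y |: A) :\ x \notin X) && (z |: ((y |: A) :\ x) \in Y)).
Proof.
move=> eqXY cA xA yA zA; set A' := _ :\ x; set B := z |: A'.
have := shadow_odds.2; rewrite eqXY eqxx => /esym/forallP allE.
have eqc (C D : {set T}) : #|C| = j -> #|D| = j.+1 -> 'C(n, j) * (n - j) * crossings X Y C D
     = (1 + #|C :\: D|) * (n`! * (j.+1 * #|Y| - (n - j) * #|X|)).
  move=> cC cD; have /forallP/(_ D)/implyP := allE C.
  by rewrite cC cD !eqxx => /(_ isT)/eqP.
have cA' : #|A'| = j.
  by have := cardsD1 x (y |: A); rewrite cardsU1 yA cA !inE xA orbT => -[].
have zA' : z \notin A' by rewrite inE negb_and zA orbT.
have cB : #|B| = j.+1 by rewrite cardsU1 zA' cA'.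
have cyA : #|y |: A| = j.+1 by rewrite cardsU1 yA cA.
have d1 : #|A :\: (y |: A)| = 0.
  by apply/eqP; rewrite cards_eq0 setD_eq0 subsetUr.
have d2 : #|A' :\: B| = 0 by apply/eqP; rewrite cards_eq0 setD_eq0 subsetUr.
(* A path of two upward edges, by d3; each half is a single edge, by d1 and d2. *)
have d3 : #|A :\: B| = 1.
  apply/eqP/cards1P; exists x; apply/setP=> t; rewrite !inE.
  case: (eqVneq t x) => [->|_]; rewrite ?xA ?andbT /=.
    by apply: contra zA; rewrite orbF => /eqP <-; rewrite !inE xA orbT.
  by case: (t \in A); rewrite ?orbT ?andbF.
have sumE : crossings X Y A B = crossings X Y A (y |: A) + crossings X Y A' B.
  have pos : 0 < 'C(n, j) * (n - j) by rewrite muln_gt0 bin_gt0 ltnW // subn_gt0.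
  apply/eqP; rewrite -(eqn_pmul2l pos) mulnDr !eqc // d1 d2 d3; apply/eqP; ring.
have pointwise (p : {perm T}) :
    (p @: A \notin X) && (p @: B \in Y) <=
    ((p @: A \notin X) && (p @: (y |: A) \in Y)) + ((p @: A' \notin X) && (p @: B \in Y)).
  case: (boolP (_ \in X)) => //= pA.
  case: (boolP (p @: B \in Y)) => //= pB; rewrite andbT.
  case: (boolP (p @: A' \in X)) => /= [pA'|]; last by rewrite addn1.
  rewrite [_ \in Y](_ : _ = true) // -(setD1K (a := x) (A := y |: A)); last first.
    by rewrite !inE xA orbT.
  rewrite imsetU1; apply: upXY => //; rewrite mem_imset ?inE ?eqxx //; exact: perm_inj.
have := leqif_sum (P := predT) (fun p _ => leqif_eq (pointwise p)).
rewrite big_split /=.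
have crE (C D : {set T}) :
    \sum_(p : {perm T}) ((p @: C \notin X) && (p @: D \in Y)) = crossings X Y C D.
  by rewrite /crossings -sum1dep_card [RHS]big_mkcond; apply: eq_bigr => p _; case: ifP.
(* Pointwise equality holds for every permutation; take the identity. *)
rewrite !crE sumE => -[_]; rewrite eqxx => /esym/forallP/(_ 1%g).
by rewrite !imset_perm1 => /eqP.
Qed.

End OneStep.

(** * Equality in the expansion *)

Section Star.
Context {T : finType} {X Y : {set {set T}}} {j : nat}.
Hypothesis sX : X \subset ksubsets [set: T] j.
Hypothesis sY : Y \subset ksubsets [set: T] j.+1.
Hypothesis upXY : up_closed X Y.
Hypothesis j_lt : j.+1 < #|T|.
Let n := #|T|.
Let cX := ksubsets [set: T] j :\: X.
Hypothesis eqXY : #|X| * (n - j) * (#|ksubsets [set: T] j.+1 :\: Y| * j.+1)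
    = #|Y| * (n - j.+1) * (#|cX| * j).
Hypothesis X_neq0 : X != set0.
Hypothesis cX_neq0 : cX != set0.

(** The edge from [L] to [y |: L] enters the upset. If [y] is the centre of the star,
    this happens exactly for the [j]-sets avoiding [y]. *)
Let crossing (y : T) (L : {set T}) :=
  [/\ #|L| = j, y \notin L, L \notin X & y |: L \in Y].

Let j_lt' : j < #|T| := ltnW j_lt.

Let card_exchange (a x : T) (L : {set T}) :
  a \in L -> x \notin L -> #|x |: (L :\ a)| = #|L|.
Proof. by move=> aL xL; rewrite cardsU1 !inE (negPf xL) andbF (cardsD1 a L) aL. Qed.

Let exists_notin (L : {set T}) : #|L| < n -> exists z, z \notin L.
Proof.
move=> cL; have /card_gt0P[z] : 0 < #|~: L| by rewrite cardsCs setCK subn_gt0.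
by rewrite inE; exists z.
Qed.

Let crossing_exists : exists y L, crossing y L.
Proof.
have [A AX] := set0Pn _ X_neq0.
have cA : #|A| = j by have := subsetP sX _ AX; rewrite inE => /andP[_ /eqP].
have [x xA] : exists x, x \notin A by apply: exists_notin; rewrite cA.
have Y_neq0 : Y != set0 by apply/set0Pn; exists (x |: A); apply: upXY.
have [E defE slack] := shadow_double_count sX sY upXY j_lt'.
(* Equality makes E proportional to the product of the sizes of Y and of the
   complement of X, both of which are nonempty. *)
have E_gt0 : 0 < E.
  rewrite lt0n; apply/eqP => E0; move: slack; rewrite E0 -/n -/cX mul0n addn0 -mulnA eqXY.
  move/eqP; rewrite mulnA -[X in X == _]addn0 eqn_add2l eq_sym !muln_eq0 !cards_eq0.
  by rewrite (negPf cX_neq0) (negPf Y_neq0) /n orbF orbF => /eqP n0; move: j_lt; rewrite n0.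
have : 0 < #|[set p : {perm T} | (p @: A \notin X) && (p @: (x |: A) \in Y)]|.
  have := crossings_edge sX sY upXY A x cA xA.
  rewrite -defE mulnDr => /addIn eqE.
  have : 0 < #|T|`! * E by rewrite muln_gt0 fact_gt0.
  by rewrite -eqE muln_gt0 => /andP[].
case/card_gt0P=> p; rewrite inE imsetU1 => /andP[pX pY].
have p_inj := @perm_inj _ p.
by exists (p x), (p @: A); split; rewrite ?mem_imset ?card_imset.
Qed.

(** On a path that starts with the crossing, the second half cannot be a crossing,
    although it also ends in [Y]; so its lower end is in [X]. *)
Let crossing_swap y L x : crossing y L -> x \in L -> (y |: L) :\ x \in X.
Proof.
case=> cL yL LX yLY xL.
have [z zL] : exists z, z \notin y |: L by apply: exists_notin; rewrite cardsU1 yL cL.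
have := shadow_odds_exchange sX sY upXY j_lt' L x y z eqXY cL xL yL zL.
by rewrite LX yLY /=; case: (_ \in Y); case: (_ \in X).
Qed.

(** The path from [x |: (L :\ a)] through [L] to [y |: L] ends with a crossing, so as
    a whole it leaves the complement of [X]; in particular it starts there. *)
Let crossing_exchange y L a x :
  crossing y L -> a \in L -> x \notin y |: L -> crossing y (x |: (L :\ a)).
Proof.
move=> crL aL xyL; have [cL yL LX yLY] := crL.
have [xy xL] : x != y /\ x \notin L by move: xyL; rewrite !inE negb_or => /andP.
have ax : a != x by apply: contraNneq xL => <-.
have ay : a != y by apply: contraNneq yL => <-.
set L' := x |: _.
have cL' : #|L'| = j by rewrite card_exchange.
have xL' : x \in L' by rewrite !inE eqxx.
have aL' : a \notin L' by rewrite !inE eqxx (negPf ax).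
have yL' : y \notin L' by rewrite !inE (negPf yL) andbF eq_sym (negPf xy).
have LE : (a |: L') :\ x = L.
  apply/setP=> t; rewrite !inE; case: (eqVneq t x) => [->|_] /=; first by rewrite (negPf xL).
  by case: (eqVneq t a) => [->|].
have yaL' : y \notin a |: L' by rewrite inE negb_or inE eq_sym ay.
have := shadow_odds_exchange sX sY upXY j_lt' L' x a y eqXY cL' xL' aL' yaL'.
rewrite LE LX yLY => ex; split=> //.
  by move: ex; case: (L' \in X).
have -> : y |: L' = x |: ((y |: L) :\ a).
  apply/setP=> t; rewrite !inE; case: (eqVneq t y) => [->|_] //=.
  by rewrite (eq_sym y a) ay orbT.
apply: upXY; first exact: crossing_swap.
by rewrite inE negb_and xyL orbT.
Qed.

Let crossing_all y (L L' : {set T}) : crossing y L -> #|L'| = j -> y \notin L' -> crossing y L'.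
Proof.
move=> + cL' yL'; have [r] := ubnP #|L' :\: L|; elim: r L => // r IHr L dr crL.
have [cL yL LX yLY] := crL.
have [dL|[x]] := set_0Vmem (L' :\: L).
  suff -> : L' = L by [].
  by apply/eqP; rewrite eqEcard -setD_eq0 dL eqxx cL cL' /=.
rewrite inE => /andP[xL xL'].
have /set0Pn[a] : L :\: L' != set0.
  rewrite -card_gt0 cardsD setIC cL -cL' -cardsD.
  by apply/card_gt0P; exists x; rewrite inE xL.
rewrite inE => /andP[aL' aL].
apply: (IHr (x |: (L :\ a))); last first.
  apply: crossing_exchange => //; rewrite !inE negb_or xL andbT.
  by apply: contraNneq yL' => <-.
rewrite -ltnS; apply: leq_trans dr; rewrite ltnS (cardsD1 x (L' :\: L)) !inE xL xL' /=.
rewrite add1n ltnS; apply/subset_leq_card/subsetP => t; rewrite !inE negb_or negb_and negbK.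
by case: (eqVneq t a) => [->|_] /=; [rewrite (negPf aL') andbF | rewrite andbA].
Qed.

(** Some [L] and [y] form a crossing. The exchange identity propagates it to
    every set obtained from [L] by swapping elements other than [y], hence to all
    [j]-sets avoiding [y], and puts into [X] the sets obtained by swapping
    [y] in. *)
Lemma shadow_odds_star : exists y, X = [set L in ksubsets [set: T] j | y \in L].
Proof.
have [y [L crL]] := crossing_exists.
exists y; apply/setP=> L'; rewrite [RHS]inE; apply/idP/andP=> [L'X|[]].
  have kL' := subsetP sX _ L'X; split=> //.
  apply/negPn/negP => yL'; move: kL'; rewrite inE => /andP[_ /eqP cL'].
  by have [_ _ /negP] := crossing_all y L L' crL cL' yL'.
rewrite inE => /andP[_ /eqP cL'] yL'.
have [z zL'] : exists z, z \notin L' by apply: exists_notin; rewrite cL'.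
have yz : y != z by apply: contraNneq zL' => <-.
have crL' : crossing y (z |: (L' :\ y)).
  by apply: (crossing_all y L) => //; rewrite ?card_exchange // !inE eqxx (negPf yz).
have := crossing_swap _ _ z crL'; rewrite !inE eqxx => /(_ isT).
congr (_ \in X); apply/setP=> t; rewrite !inE.
case: (eqVneq t z) => [->|_] /=; first by rewrite (negPf zL').
by case: (eqVneq t y) => [->|].
Qed.

End Star.

(** * Upsets across several levels *)

Definition up_level {T : finType} (X : {set {set T}}) (j : nat) : {set {set T}} :=
  [set B in ksubsets [set: T] j | [exists A in X, A \subset B]].

(** The odds of belonging to the upset of [X] at level [j], divided by the odds for
    the sets through a fixed point, which are [j / (n - j)]. *)
Definition normalized_odds {T : finType} (X : {set {set T}}) (j : nat) : rat :=
  ((#|up_level X j| * (#|T| - j))%:R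
   / (#|ksubsets [set: T] j :\: up_level X j| * j)%:R)%R.

Section Ladder.
Context {T : finType} {X : {set {set T}}}.
Let n := #|T|.
Let codown j := ksubsets [set: T] j :\: up_level X j.

Lemma up_level_sub j : up_level X j \subset ksubsets [set: T] j.
Proof. by apply/subsetP => B; rewrite inE => /andP[]. Qed.

Lemma up_level_id j : X \subset ksubsets [set: T] j -> up_level X j = X.
Proof.
move=> sX; apply/setP=> B; rewrite inE; apply/andP/idP=> [[]|BX].
  rewrite inE => /andP[_ /eqP cB] /existsP[A /andP[AX AB]].
  suff <- : A = B by [].
  have := subsetP sX _ AX; rewrite inE => /andP[_ /eqP cA].
  by apply/eqP; rewrite eqEcard AB cA cB /=.
by split; [exact: (subsetP sX) | apply/existsP; exists B; rewrite BX subxx].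
Qed.

Lemma up_level_closed j : up_closed (up_level X j) (up_level X j.+1).
Proof.
move=> A x; rewrite !inE !subsetT /= => /andP[/eqP cA /existsP[L /andP[LX LA]]] xA.
rewrite cardsU1 xA cA add1n eqxx; apply/existsP; exists L.
by rewrite LX (subset_trans LA) // subsetUr.
Qed.

Lemma codown_neq0 j m : j <= m -> codown m != set0 -> codown j != set0.
Proof.
move=> jm /set0Pn[B]; rewrite !inE subsetT negb_and /= andb_orl => /orP[|].
  by case/andP=> /negPf->.
case/andP=> noB /eqP cB.
have /card_gt0P[A] : 0 < #|[set A : {set T} | A \subset B & #|A| == j]|.
  by rewrite cards_draws cB bin_gt0.
rewrite inE => /andP[AB cA]; apply/set0Pn; exists A; rewrite !inE subsetT cA /= andbT.
apply: contra noB => /existsP[L /andP[LX LA]].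
by apply/existsP; exists L; rewrite LX (subset_trans LA AB).
Qed.

Lemma codown_le j : codown j != set0 -> j <= n.
Proof.
by case/set0Pn=> B; rewrite !inE => /andP[_ /andP[_ /eqP <-]]; exact: max_card.
Qed.

(** One application of [shadow_odds], written as a monotone quantity so that it
    can be chained over levels. *)
Lemma normalized_odds_step j : 0 < j -> codown j.+1 != set0 ->
  ((normalized_odds X j <= normalized_odds X j.+1)%R) /\
  (normalized_odds X j = normalized_odds X j.+1 ->
    #|up_level X j| * (n - j) * (#|codown j.+1| * j.+1)
    = #|up_level X j.+1| * (n - j.+1) * (#|codown j| * j)).
Proof.
move=> j_gt0 c1.
have c0 := codown_neq0 j j.+1 (leqnSn j) c1.
have jn := codown_le _ c1.
have [le _] := shadow_odds (up_level_sub j) (up_level_sub j.+1) (up_level_closed j) jn.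
have p0 : (0 < (#|codown j| * j)%:R :> rat)%R.
  by rewrite ltr0n muln_gt0 card_gt0 c0.
have p1 : (0 < (#|codown j.+1| * j.+1)%:R :> rat)%R.
  by rewrite ltr0n muln_gt0 card_gt0 c1.
rewrite /normalized_odds; split.
  by rewrite ler_pdivrMr // mulrAC ler_pdivlMr // -!natrM ler_nat.
by move/eqP; rewrite eqr_div ?(gt_eqF p0) ?(gt_eqF p1) // -!natrM eqr_nat => /eqP ->.

Qed.

Lemma normalized_odds_le j m : 0 < j -> j <= m -> codown m != set0 ->
  (normalized_odds X j <= normalized_odds X m)%R.
Proof.
move=> j_gt0; elim: m => [|m IHm]; first by rewrite leqn0 => /eqP->.
rewrite leq_eqVlt => /orP[/eqP -> //|]; rewrite ltnS => jm cm.
have [le _] := normalized_odds_step _ (leq_trans j_gt0 jm) cm.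
by apply: le_trans le; apply: IHm => //; apply: codown_neq0 cm.
Qed.

End Ladder.

(** The equality case of the Erdos-Ko-Rado theorem. The normalized odds of [X] are 1 at
    level [l]. At level [n - l] they are at most 1, since the complements of
    members of [X] contain no member of [X]. As they never decrease with the level,
    they are constant in between, and [shadow_odds_star] applies to the first step. *)
Lemma intersecting_max_star (T : finType) (X : {set {set T}}) (l : nat) :
  0 < l -> 2 * l < #|T| -> X \subset ksubsets [set: T] l ->
  {in X &, forall A B : {set T}, ~~ [disjoint A & B]} ->
  #|T| * #|X| = l * 'C(#|T|, l) ->
  exists y, X = [set L in ksubsets [set: T] l | y \in L].
Proof.
set n := #|T| => l_gt0 l_lt sX intX cX.
have ln : l < n by lia.
have cardX := cardsC_ksubsets _ _ _ sX; rewrite -/n in cardX.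
have N_gt0 : 0 < 'C(n, l) by rewrite bin_gt0 ltnW.
have X_gt0 : 0 < #|X|.
  move: cX; case: #|X| => //; rewrite muln0 => /esym/eqP.
  by rewrite muln_eq0 !gtn_eqF.
have X_neq0 : X != set0 by rewrite -card_gt0.
set c := #|_ :\: X| in cardX.
have c_gt0 : 0 < c.
  rewrite lt0n; apply/eqP => c0; move: cX; rewrite -cardX c0 addn0 => /eqP.
  by rewrite eqn_pmul2r // gtn_eqF.
pose d := #|ksubsets [set: T] (n - l) :\: up_level X (n - l)|.
have le_Xd : #|X| <= d.
  rewrite -(card_imset _ (@setC_inj T)); apply/subset_leq_card/subsetP => _ /imsetP[A AX ->].
  have := subsetP sX _ AX; rewrite !inE !subsetT /= => /eqP cA.
  rewrite cardsCs setCK cA eqxx /= andbT.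
  apply/negP => /existsP[L /andP[LX]]; rewrite -disjoints_subset => dLA.
  by have := intX _ _ LX AX; rewrite dLA.
have d_gt0 : 0 < d by apply: leq_trans le_Xd.
have top_neq0 : ksubsets [set: T] (n - l) :\: up_level X (n - l) != set0.
  by rewrite -card_gt0.
have cardU : #|up_level X (n - l)| + d = 'C(n, l).
  by rewrite -(bin_sub (ltnW ln)); apply: cardsC_ksubsets; exact: up_level_sub.
have h1 : #|X| * (n - l) = c * l.
  apply/eqP; rewrite -(eqn_add2r (#|X| * l)) -mulnDr subnK ?(ltnW ln) //.
  by rewrite -mulnDl mulnC cX -cardX mulnC addnC.
have bottom : normalized_odds X l = 1%R.
  rewrite /normalized_odds up_level_id // -/n -/c h1.
  by rewrite divff // pnatr_eq0 muln_eq0 !gtn_eqF.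
have top : (normalized_odds X (n - l) <= 1)%R.
  rewrite /normalized_odds -/n -/d ler_pdivrMr ?ltr0n ?muln_gt0 ?d_gt0 ?subn_gt0 //.
  rewrite mul1r ler_nat (subKn (ltnW ln)).
  apply: leq_trans (leq_mul le_Xd (leqnn _)); rewrite h1 leq_mul2r.
  by apply/orP; right; lia.
have lt_l_nl : l < n - l by lia.
have next_neq0 := codown_neq0 l.+1 (n - l) lt_l_nl top_neq0.
have [le1 eq1] := normalized_odds_step l l_gt0 next_neq0.
have le2 := normalized_odds_le l.+1 (n - l) isT lt_l_nl top_neq0.
have eqw : normalized_odds X l = normalized_odds X l.+1.
  by apply/eqP; rewrite eq_le le1 bottom (le_trans le2 top).
have := eq1 eqw; rewrite up_level_id // => eqXY.
have up1 := @up_level_closed T X l; rewrite up_level_id // in up1.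
have c_neq0 : ksubsets [set: T] l :\: X != set0 by rewrite -card_gt0.
have lt_n : l.+1 < #|T| by rewrite -/n; lia.
exact: shadow_odds_star sX (up_level_sub l.+1) up1 lt_n eqXY X_neq0 c_neq0.
Qed.

(** * Counting and numerical estimates *)

Lemma sum_missing_off (T : finType) (F : {set {set T}}) (k l : nat) :
  \sum_(L in ksubsets [set: T] l) #|missing_off F k L|
  = 'C(#|T| - k, l) * #|ksubsets [set: T] k :\: F|.
Proof.
transitivity (\sum_(L in ksubsets [set: T] l)
   \sum_(B in ksubsets [set: T] k :\: F | [disjoint L & B]) 1).
  apply: eq_bigr => L _; rewrite sum1dep_card; apply: eq_card => B.
  by rewrite !inE subsetT; case: (B \in F); rewrite ?andbF ?andbT.
rewrite (exchange_big_dep (mem (ksubsets [set: T] k :\: F))) => [|L B _ /andP[]] //=.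
rewrite mulnC -sum_nat_const; apply: eq_bigr => B; rewrite !inE subsetT /= => /andP[BF /eqP cB].
have -> : #|T| - k = #|~: B| by rewrite [RHS]cardsCs setCK cB.
rewrite sum1dep_card -cards_draws; apply: eq_card => L.
by rewrite !inE subsetT BF cB eqxx /= disjoints_subset andbC.
Qed.

(** Each of the [l] points to be avoided belongs to a proportion [k / n] of the
    [k]-sets. *)
Lemma bin_avoid_ge (n k l : nat) : l <= n ->
  n * 'C(n, k) <= n * 'C(n - l, k) + l * k * 'C(n, k).
Proof.
case: k => [|k] ln; first by rewrite !bin0 leq_addr.
have : 'C(n, k.+1) <= 'C(n - l, k.+1) + l * 'C(n.-1, k).
  elim: l ln => [|l IHl] ln; first by rewrite subn0 leq_addr.
  apply: leq_trans (IHl (ltnW ln)) _.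
  have -> : n - l = (n - l.+1).+1 by lia.
  rewrite binS mulSn addnA leq_add2r leq_add2l leq_bin2l //; lia.
by move=> h; rewrite -mulnA -mul_bin_diag (mulnCA l) -mulnDr leq_mul2l h orbT.
Qed.

(** The comparison of the odds puts [lam] below a hyperbola in [q]. For [q] at most the
    star density [k / n] this hyperbola lies below the chord through the origin
    and the star point [(k / n, l / n)]. *)
Lemma odds_bound_low (n k l q lam : rat) : (l <= k -> k < n -> 0 <= lam ->
  lam * (n - l) * ((1 - q) * k) <= q * (n - k) * ((1 - lam) * l) ->
  n * q <= k -> lam * k <= q * l)%R.
Proof.
move=> lk kn lam0 odds qk.
have gap : (0 <= lam * ((k - l) * (k - n * q)))%R by rewrite !mulr_ge0 // subr_ge0.
rewrite -(ler_pM2r (_ : 0 < n - k)%R) ?subr_gt0 // -subr_ge0.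
have -> : (q * l * (n - k) - lam * k * (n - k) = lam * ((k - l) * (k - n * q))
    + (q * (n - k) * ((1 - lam) * l) - lam * (n - l) * ((1 - q) * k)))%R by ring.
by rewrite addr_ge0 // subr_ge0.
Qed.

(** The same hyperbola meets the line [lam = q - (k - l) / n] at [q = k / n] and
    [q = 1 - l / n], and is below it in between. *)
Lemma odds_bound_high {n k l q lam : rat} :
  (0 < l <= k -> k < n -> 0 <= lam ->
  lam * (n - l) * ((1 - q) * k) <= q * (n - k) * ((1 - lam) * l) ->
  k < n * q < n - l ->
  lam * n <= n * q - (k - l) /\ (l < k -> lam * n < n * q - (k - l)))%R.
Proof.
move=> /andP[l0 lk] kn lam0 odds /andP[kq qn].
have k0 : (0 < k)%R by apply: lt_le_trans lk.
have n0 : (0 < n)%R by apply: lt_trans kn.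
have q0 : (0 < q)%R by rewrite -(pmulr_rgt0 _ n0); apply: lt_trans kq.
have q1 : (0 < 1 - q)%R.
  by rewrite subr_gt0 -(ltr_pM2l n0) mulr1; apply: lt_trans qn _; rewrite gtrBl.
pose D := ((n - l) * ((1 - q) * k) + q * (n - k) * l)%R.
have D0 : (0 < D)%R.
  have nk : (0 < n - k)%R by rewrite subr_gt0.
  have nl : (0 < n - l)%R by rewrite subr_gt0 (le_lt_trans lk).
  by apply: addr_gt0; rewrite !mulr_gt0.
have key : ((n * q - (k - l) - lam * n) * D
   = (k - l) * ((n * q - k) * (n - l - n * q))
     + n * (q * (n - k) * ((1 - lam) * l) - lam * (n - l) * ((1 - q) * k)))%R.
  by rewrite /D; ring.
have t2 : (0 <= n * (q * (n - k) * ((1 - lam) * l) - lam * (n - l) * ((1 - q) * k)))%R.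
  by rewrite mulr_ge0 ?subr_ge0 // ltW.
have t1 : (0 < (n * q - k) * (n - l - n * q))%R by rewrite mulr_gt0 // subr_gt0.
split=> [|lk'].
  have : (0 <= (n * q - (k - l) - lam * n) * D)%R.
    by rewrite key addr_ge0 // mulr_ge0 ?subr_ge0 // ltW.
  by rewrite pmulr_lge0 // subr_ge0.
have : (0 < (n * q - (k - l) - lam * n) * D)%R.
  by rewrite key ltr_wpDr // mulr_gt0 ?subr_gt0.
by rewrite pmulr_lgt0 // subr_gt0.
Qed.

(** Here [q i] and [lam i] are the proportions of [k]-sets missing from [F i] and of
    [l]-sets contained in no member of [F i]. The bound is [Q >= 1 + (k - l) / n].
    If some [q i] lies between [k / n] and [1 - l / n], it follows from
    [Q >= 1 + q i - lam i] and [odds_bound_high]. If some [q i] is at least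
    [1 - l / n], it follows from [Q >= q i + e], as [e] is close to 1. If all
    [q i] are at most [k / n], then [Q >= 1 + q i * (1 - l / k)], and averaging over
    [i] gives an inequality for [Q] alone. *)
Lemma deficiency_bound (n k l s : nat) (q lam : 'I_s.+1 -> rat) (e : rat) :
  n = s * k + l -> 0 < l -> l <= k -> 4 * l <= s ->
  let Q := (\sum_i q i)%R in
  (forall i, 0 <= lam i)%R ->
  (forall i, lam i * (n%:R - l%:R) * ((1 - q i) * k%:R)
     <= q i * (n%:R - k%:R) * ((1 - lam i) * l%:R))%R ->
  (forall i, 1 - lam i <= Q - q i)%R ->
  (forall i, e <= Q - q i)%R -> (n%:R - (l * k)%:R <= n%:R * e)%R ->
  ((s.+1 * k)%:R <= n%:R * Q)%R /\
  (n%:R * Q = (s.+1 * k)%:R -> forall i, q i < e /\ Q - q i = 1 - lam i)%R.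
Proof.
move=> nE l0 lk s4 Q lam0 odds cover far e_ge.
have k0 : 0 < k by apply: leq_trans lk.
have kn : k < n by nia.
have nk : (3 * l * k < n)%N by nia.
have target : ((s.+1 * k)%:R = n%:R + (k%:R - l%:R) :> rat)%R.
  by rewrite nE mulSn !natrD; ring.
have l0' : (0 < l%:R :> rat)%R by rewrite ltr0n.
have lk' : (l%:R <= k%:R :> rat)%R by rewrite ler_nat.
have k0' : (0 < k%:R :> rat)%R by rewrite ltr0n.
have kn' : (k%:R < n%:R :> rat)%R by rewrite ltr_nat.
have n0' : (0 < n%:R :> rat)%R by apply: lt_trans kn'.
have l_le : (l%:R <= (l * k)%:R :> rat)%R by rewrite ler_nat; nia.
have k_le : (k%:R <= (l * k)%:R :> rat)%R by rewrite ler_nat; nia.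
have nk' : (3 * (l * k)%:R < n%:R :> rat)%R by rewrite -natrM ltr_nat mulnA.
have farn i : (n%:R - (l * k)%:R <= n%:R * Q - n%:R * q i)%R.
  apply: le_trans e_ge _; rewrite -mulrBr ler_pM2l //.
have covern i : (n%:R - n%:R * lam i <= n%:R * Q - n%:R * q i)%R.
  by have := cover i; rewrite -(ler_pM2l n0') !mulrBr mulr1.
have caseA i : (n%:R - l%:R <= n%:R * q i -> (s.+1 * k)%:R < n%:R * Q)%R.
  by have := farn i; rewrite target; lra.
have caseE i : (e <= q i -> (s.+1 * k)%:R < n%:R * Q)%R.
  by rewrite -(ler_pM2l n0') => eq; have := farn i; rewrite target; lra.
have caseB i : (k%:R < n%:R * q i < n%:R - l%:R ->
    (s.+1 * k)%:R <= n%:R * Q /\ ((l < k)%N -> (s.+1 * k)%:R < n%:R * Q))%R.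
  have l01 : (0 < (l%:R : rat) <= k%:R)%R by rewrite l0'.
  move=> /(odds_bound_high l01 kn' (lam0 i) (odds i)) [b1 b2].
  have := covern i; rewrite target; split; first by lra.
  by rewrite -(ltr_nat rat) => /b2; lra.
have caseC i : (n%:R * q i <= k%:R -> lam i * k%:R <= q i * l%:R)%R.
  exact: odds_bound_low.
have allC : (forall i, n%:R * q i <= k%:R)%R -> ((s.+1 * k)%:R <= n%:R * Q)%R.
  move=> allq.
  have sumC : (\sum_(i < s.+1) (k%:R + q i * (k%:R - l%:R)) <= \sum_(i < s.+1) k%:R * Q)%R.
    apply: ler_sum => i _; have := caseC i (allq i).
    have : (k%:R * (1 - lam i) <= k%:R * (Q - q i))%R by rewrite ler_pM2l.
    lra.
  move: sumC; rewrite big_split /= -mulr_suml -/Q !sumr_const !card_ord.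
  rewrite -mulr_natr -[X in (_ <= X)%R]mulr_natr.
  rewrite natrM nE natrD natrM -addn1 natrD; lra.
have le : ((s.+1 * k)%:R <= n%:R * Q)%R.
  case: (boolP [forall i, n%:R * q i <= k%:R]%R) => [/forallP|]; first exact: allC.
  rewrite negb_forall => /existsP[i]; rewrite -ltNge => kq.
  have [/caseA/ltW //|qn] := leP (n%:R - l%:R)%R (n%:R * q i)%R.
  by case: (caseB i); rewrite ?kq.
split=> // eqQ i; split.
  by rewrite ltNge; apply/negP => /caseE; rewrite eqQ ltxx.
have [lk2|kl] := ltnP l k; last first.
  (* For l = k the bound on lam i is not strict, but it says that lam i <= q i,
     and Q = 1 gives the reverse inequality. *)
  have lkE : l = k by apply/eqP; rewrite eqn_leq lk kl.
  have nQ : (n%:R * Q = n%:R)%R by rewrite eqQ target lkE; ring.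
  have lamq : (lam i <= q i)%R.
    have pos : (0 < (n%:R - k%:R) * k%:R :> rat)%R by rewrite mulr_gt0 // subr_gt0.
    rewrite -(ler_pM2r pos); have := odds i; rewrite lkE; lra.
  have := covern i; rewrite nQ => cov.
  apply: (mulfI (lt0r_neq0 n0')); rewrite !mulrBr nQ mulr1.
  have := lamq; rewrite -(ler_pM2l n0'); lra.
have allq j : (n%:R * q j <= k%:R)%R.
  rewrite leNgt; apply/negP => kq.
  have [/caseA|qn] := leP (n%:R - l%:R)%R (n%:R * q j)%R; first by rewrite eqQ ltxx.
  by case: (caseB j); rewrite ?kq // => _ /(_ lk2); rewrite eqQ ltxx.
have sumq : (\sum_(j < s.+1) (k%:R - n%:R * q j) = 0)%R.
  rewrite big_split /= sumr_const card_ord sumrN -mulr_sumr -/Q eqQ natrM.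
  by rewrite -mulr_natr; ring.
have qE : (n%:R * q i = k%:R)%R.
  have nonneg j : xpredT j -> (0 <= k%:R - n%:R * q j)%R by rewrite subr_ge0.
  have /eqP : (k%:R - n%:R * q i = 0)%R by apply: (psumr_eq0P nonneg sumq).
  by rewrite subr_eq0 => /eqP.
have lamE : (n%:R * lam i <= l%:R)%R.
  by have := caseC i (allq i); rewrite -(ler_pM2l n0') mulrA mulrA qE mulrC ler_pM2l.
apply: (mulfI (lt0r_neq0 n0')); rewrite !mulrBr mulr1.
by have := covern i; move: eqQ; rewrite target qE; lra.
Qed.

(** * Uncovered l-sets of a cross-union system *)

Definition uncovered {T : finType} (F : {set {set T}}) (l : nat) : {set {set T}} :=
  [set L in ksubsets [set: T] l | [forall A in F, ~~ (L \subset A)]].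

Lemma uncovered_sub {T : finType} (F : {set {set T}}) l :
  uncovered F l \subset ksubsets [set: T] l.
Proof. by apply/subsetP => L; rewrite inE => /andP[]. Qed.

(** The upset of the uncovered [l]-sets avoids [F] at level [k], so the monotonicity
    of the normalized odds compares the two missing densities. *)
Lemma uncovered_odds (T : finType) (F : {set {set T}}) (k l : nat) :
  0 < l -> l <= k -> F \subset ksubsets [set: T] k -> F != set0 ->
  #|uncovered F l| * (#|T| - l) * (#|F| * k)
  <= #|ksubsets [set: T] k :\: F| * (#|T| - k) * (('C(#|T|, l) - #|uncovered F l|) * l).
Proof.
move=> l0 lk sF F0; set U := uncovered F l.
have sU : U \subset ksubsets [set: T] l by exact: uncovered_sub.
have upF : up_level U k \subset ksubsets [set: T] k :\: F.
  apply/subsetP => B; rewrite inE => /andP[kB /existsP[L /andP[LU LB]]].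
  rewrite inE kB andbT; apply: contraL LB => BF.
  by move: LU; rewrite inE => /andP[_ /forall_inP]; apply.
have Fup : F \subset ksubsets [set: T] k :\: up_level U k.
  apply/subsetP => B BF; rewrite inE (subsetP sF) // andbT.
  by apply: contraL BF => /(subsetP upF); rewrite inE => /andP[].
have k_neq0 : ksubsets [set: T] k :\: up_level U k != set0.
  by apply: contraNneq F0 => e; rewrite -subset0 -e.
have l_neq0 := codown_neq0 l k lk k_neq0.
have := normalized_odds_le l k l0 lk k_neq0; rewrite /normalized_odds up_level_id //.
rewrite up_level_id // in l_neq0.
have k0 : 0 < k by apply: leq_trans lk.
rewrite ler_pdivrMr ?ltr0n ?muln_gt0 ?card_gt0 ?l_neq0 //.
rewrite mulrAC ler_pdivlMr ?ltr0n ?muln_gt0 ?card_gt0 ?k_neq0 // -!natrM ler_nat => le.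
have -> : 'C(#|T|, l) - #|U| = #|ksubsets [set: T] l :\: U|.
  by rewrite -(cardsC_ksubsets _ _ _ sU) addKn.
apply: leq_trans (leq_trans _ le) _.
  by rewrite leq_mul2l leq_mul2r (subset_leq_card Fup) !orbT.
by rewrite leq_mul2r leq_mul2r (subset_leq_card upF) !orbT.
Qed.

Lemma card_ksubsets (T : finType) (k : nat) : #|ksubsets [set: T] k| = 'C(#|T|, k).
Proof. by rewrite cards_draws cardsT. Qed.

Section CrossUnion.
Context {n k s l : nat} {F : 'I_s.+1 -> {set {set 'I_n}}}.
Context (l_gt0 : 0 < l) (l_le_k : l <= k) (n_eq : n = s * k + l) (s_ge : 4 * l <= s).
Context (F_sub : forall i, F i \subset ksubsets [set: 'I_n] k).
Context (F_neq0 : forall i, F i != set0) (F_cross : cross_union F).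

Let U i := uncovered (F i) l.
Let m i := #|ksubsets [set: 'I_n] k :\: F i|.
Let q i : rat := ((m i)%:R / 'C(n, k)%:R)%R.
Let lam i : rat := (#|U i|%:R / 'C(n, l)%:R)%R.
Let e : rat := ('C(n - l, k)%:R / 'C(n, k)%:R)%R.
Let Q : rat := (\sum_i q i)%R.

Let k_gt0 : 0 < k. Proof. exact: leq_trans l_le_k. Qed.
Let n_ge : 4 * k + l <= n. Proof. by rewrite n_eq leq_add2r leq_mul2r; apply/orP; right; lia. Qed.
Let Nk_gt0 : 0 < 'C(n, k). Proof. by rewrite bin_gt0; lia. Qed.
Let Nl_gt0 : 0 < 'C(n, l). Proof. by rewrite bin_gt0; lia. Qed.
Let c_gt0 : 0 < 'C(n - l, k). Proof. by rewrite bin_gt0; lia. Qed.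
Let cardF i : #|F i| + m i = 'C(n, k).
Proof. by rewrite /m cardsC_ksubsets // card_ord. Qed.

Let le_m i : m i <= 'C(n, k). Proof. by rewrite -(cardF i) leq_addl. Qed.
Let le_U i : #|U i| <= 'C(n, l).
Proof. by rewrite -[n in 'C(n, l)]card_ord -card_ksubsets subset_leq_card // uncovered_sub. Qed.

Let missing i L := #|missing_off (F i) k L|.

Let missing_le i L : missing i L <= m i.
Proof.
apply/subset_leq_card/subsetP => B; rewrite !inE subsetT.
by case/andP=> /andP[-> _] ->.
Qed.

Let missing_ge i0 L : L \in ksubsets [set: 'I_n] l -> L \notin U i0 ->
  'C(n - l, k) <= \sum_(i | i != i0) missing i L.
Proof.
move=> kL; rewrite inE kL /= negb_forall => /existsP[A].
rewrite negb_imply negbK => /andP[AF LA].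
apply: cross_union_missing_off n_eq F_cross AF LA _.
by move: kL; rewrite inE => /andP[_ /eqP].
Qed.

(** The gap in the inequality is what the uncovered [l]-sets contribute; keeping it
    makes the equality case readable. *)
Let sum_missing i0 :
  'C(n - l, k) * ('C(n, l) - #|U i0|) + \sum_(L in U i0) \sum_(i | i != i0) missing i L
  <= 'C(n - k, l) * \sum_(i | i != i0) m i.
Proof.
have -> : 'C(n - k, l) * \sum_(i | i != i0) m i
    = \sum_(L in ksubsets [set: 'I_n] l) \sum_(i | i != i0) missing i L.
  rewrite exchange_big big_distrr /=; apply: eq_bigr => i _.
  by rewrite sum_missing_off card_ord.
have sU := uncovered_sub (F i0) l.
rewrite [leqRHS](big_setID (U i0)) /= (setIidPr sU) addnC leq_add2l.
have -> : 'C(n, l) - #|U i0| = #|ksubsets [set: 'I_n] l :\: U i0|.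
  by rewrite cardsD (setIidPr sU) card_ksubsets card_ord.
rewrite mulnC -sum_nat_const; apply: leq_sum => L.
by rewrite inE => /andP[LU kL]; apply: missing_ge.
Qed.

Let bin_swap : 'C(n, k) * 'C(n - k, l) = 'C(n, l) * 'C(n - l, k).
Proof.
have h1 := bin_fact (_ : k <= n); have h2 := bin_fact (_ : l <= n - k).
have h3 := bin_fact (_ : l <= n); have h4 := bin_fact (_ : k <= n - l).
have pos : 0 < k`! * l`! * (n - k - l)`! by rewrite !muln_gt0 !fact_gt0.
apply/eqP; rewrite -(eqn_pmul2r pos); apply/eqP; transitivity n`!.
  by rewrite -h1 -?h2; [ring|lia|lia].
by rewrite -h3 -?h4; [rewrite -subnDA addnC subnDA; ring|lia|lia].
Qed.

Let sum_other (i0 : 'I_s.+1) : ((\sum_(i | i != i0) m i)%:R / 'C(n, k)%:R = Q - q i0)%R.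
Proof.
have -> : Q = (q i0 + \sum_(i | i != i0) q i)%R by rewrite /Q (bigD1 i0).
by rewrite addrC addKr natr_sum mulr_suml.
Qed.

Let odds i : (lam i * (n%:R - l%:R) * ((1 - q i) * k%:R)
     <= q i * (n%:R - k%:R) * ((1 - lam i) * l%:R))%R.
Proof.
have := uncovered_odds _ _ _ _ l_gt0 l_le_k (F_sub i) (F_neq0 i).
rewrite card_ord -/(U i) -/(m i) -(ler_nat rat) !natrM.
have -> : #|F i| = 'C(n, k) - m i by rewrite -(cardF i) addnK.
rewrite !natrB //; [|lia|lia].
have a0 : (0 < 'C(n, k)%:R :> rat)%R by rewrite ltr0n.
have b0 : (0 < 'C(n, l)%:R :> rat)%R by rewrite ltr0n.
rewrite /q /lam => h.
rewrite -(ler_pM2r a0) -(ler_pM2r b0).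
set a := ('C(n, k)%:R)%R in a0 h *; set b := ('C(n, l)%:R)%R in b0 h *.
have a1 : (a != 0)%R by rewrite gt_eqF.
have b1 : (b != 0)%R by rewrite gt_eqF.
by move: h; congr (_ <= _)%R; field; rewrite ?a1 ?b1.
Qed.

Let cover_count i0 :
  'C(n, k) * ('C(n, l) - #|U i0|) * 'C(n - l, k)
    + 'C(n, k) * \sum_(L in U i0) \sum_(i | i != i0) missing i L
  <= 'C(n, l) * (\sum_(i | i != i0) m i) * 'C(n - l, k).
Proof.
rewrite -mulnA -mulnDr [_ * 'C(n - l, k)]mulnC [leqRHS]mulnAC -bin_swap -mulnA.
by rewrite leq_mul2l sum_missing orbT.
Qed.

Let cover_rat i0 : (1 - lam i0 = ('C(n, k) * ('C(n, l) - #|U i0|))%:R / ('C(n, k) * 'C(n, l))%:R)%R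
  /\ (Q - q i0 = ('C(n, l) * (\sum_(i | i != i0) m i))%:R / ('C(n, k) * 'C(n, l))%:R)%R.
Proof.
have a1 : ('C(n, k)%:R != 0 :> rat)%R by rewrite pnatr_eq0 -lt0n.
have b1 : ('C(n, l)%:R != 0 :> rat)%R by rewrite pnatr_eq0 -lt0n.
by rewrite -sum_other /lam !natrM natrB //; split; field; rewrite ?a1 ?b1.
Qed.

Let cover i : (1 - lam i <= Q - q i)%R.
Proof.
have [-> ->] := cover_rat i.
rewrite ler_pM2r ?invr_gt0 ?ltr0n ?muln_gt0 ?Nk_gt0 // ler_nat.
by rewrite -(leq_pmul2r c_gt0); apply: leq_trans (cover_count i); apply: leq_addr.
Qed.

Let cover_tight i0 i L :
  (Q - q i0 = 1 - lam i0)%R -> L \in U i0 -> i != i0 -> missing i L = 0.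
Proof.
have [-> ->] := cover_rat i0; move/eqP.
rewrite (inj_eq (mulIf _)) ?invr_eq0 ?pnatr_eq0 -?lt0n ?muln_gt0 ?Nk_gt0 //.
rewrite eqr_nat => /eqP eqc LU ii0; have := cover_count i0.
rewrite eqc -[leqRHS]addn0 leq_add2l leqn0 muln_eq0 gtn_eqF //= sum_nat_eq0.
by move=> /forall_inP/(_ L LU); rewrite sum_nat_eq0 => /forall_inP/(_ i ii0)/eqP.
Qed.

Let far i0 : (e <= Q - q i0)%R.
Proof.
rewrite -sum_other ler_pM2r ?invr_gt0 ?ltr0n // ler_nat.
have [A AF] := set0Pn _ (F_neq0 i0).
have := subsetP (F_sub i0) _ AF; rewrite inE => /andP[_ /eqP cA].
have /card_gt0P[L] : 0 < #|[set L : {set 'I_n} | L \subset A & #|L| == l]|.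
  by rewrite cards_draws cA bin_gt0.
rewrite inE => /andP[LA cL].
have kL : L \in ksubsets [set: 'I_n] l by rewrite inE subsetT.
have LU : L \notin U i0.
  rewrite inE kL /= negb_forall; apply/existsP; exists A.
  by rewrite AF LA.
apply: leq_trans (missing_ge _ _ kL LU) _.
by apply: leq_sum => i _; apply: missing_le.
Qed.

Let e_ge : (n%:R - (l * k)%:R <= n%:R * e)%R.
Proof.
have a0 : (0 < 'C(n, k)%:R :> rat)%R by rewrite ltr0n.
rewrite /e mulrA ler_pdivlMr // mulrBl lerBlDr -!natrM -natrD ler_nat.
by apply: bin_avoid_ge; lia.
Qed.

Let lam_ge0 i : (0 <= lam i)%R. Proof. by rewrite divr_ge0 ?ler0n. Qed.

Lemma cross_union_deficiency :
  ((s.+1 * k)%:R <= n%:R * Q)%R /\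
  (n%:R * Q = (s.+1 * k)%:R -> forall i, q i < e /\ Q - q i = 1 - lam i)%R.
Proof. by apply: (deficiency_bound n k l s q lam e). Qed.

(** If [L] were uncovered for [F i] but covered for [F j], then only [F i] could be
    missing sets disjoint from [L], so it would miss too many of them. *)
Let uncovered_eq : (n%:R * Q = (s.+1 * k)%:R)%R -> forall i j, U i \subset U j.
Proof.
move=> eqQ i j; have [->|ij] := eqVneq i j; first exact: subxx.
apply/subsetP => L LU; apply: contraT => LUj.
have kL := subsetP (uncovered_sub _ _) _ LU.
have [_ tight] := cross_union_deficiency.
have [qi Qi] := tight eqQ i.
have := missing_ge _ _ kL LUj; rewrite (bigD1 i) //= big1 ?addn0; last first.
  by move=> i' /andP[_ i'i]; apply: (cover_tight i).
move=> le; move: qi; rewrite /q /e ltr_pM2r ?invr_gt0 ?ltr0n // ltr_nat ltnNge.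
by rewrite (leq_trans le (missing_le _ _)).
Qed.

(** In the equality case all families leave the same [l]-sets uncovered, and every
    [k]-set disjoint from such an [L] belongs to all families. Hence two disjoint
    uncovered sets are impossible: a [k]-set containing one and avoiding the other
    would be both in and out. So the uncovered sets form an intersecting family of
    density [l / n], which is a star, and its centre lies in no member of any [F i]. *)
Lemma cross_union_extremal : (n%:R * Q = (s.+1 * k)%:R)%R ->
  exists x : 'I_n, forall i, F i = ksubsets ([set: 'I_n] :\ x) k.
Proof.
move=> eqQ; have [_ /(_ eqQ) tight] := cross_union_deficiency.
have s_gt0 : 0 < s by lia.
have UE i j : U i = U j by apply/eqP; rewrite eqEsubset !uncovered_eq.
have lamE i : lam i = lam ord0 by rewrite /lam (UE i ord0).
have qE i : q i = q ord0.
  have := (tight i).2; have := (tight ord0).2; rewrite (lamE i) => <- /eqP.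
  by rewrite (inj_eq (addrI _)) eqr_opp => /eqP.
have n0 : (0 < n%:R :> rat)%R by rewrite ltr0n; lia.
have QE : (Q = s.+1%:R * q ord0)%R.
  by rewrite /Q (eq_bigr _ (fun i _ => qE i)) sumr_const card_ord mulr_natl.
have nq : (n%:R * q ord0 = k%:R)%R.
  apply: (mulfI (_ : s.+1%:R != 0)%R); first by rewrite pnatr_eq0.
  by rewrite mulrCA -QE eqQ natrM.
have nlam : (n%:R * lam ord0 = l%:R)%R.
  have h : (n%:R * (Q - q ord0) = n%:R * (1 - lam ord0))%R by rewrite (tight ord0).2.
  have nE : (n%:R = s%:R * k%:R + l%:R :> rat)%R by rewrite {1}n_eq natrD natrM.
  move: h; rewrite !mulrBr mulr1 eqQ nq mulSn natrD natrM; lra.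
have cU : n * #|U ord0| = l * 'C(n, l).
  have b1 : ('C(n, l)%:R != 0 :> rat)%R by rewrite pnatr_eq0 -lt0n.
  by apply/eqP; rewrite -(eqr_nat rat) !natrM -nlam -mulrA divfK.
have cm i : n * m i = k * 'C(n, k).
  have b1 : ('C(n, k)%:R != 0 :> rat)%R by rewrite pnatr_eq0 -lt0n.
  by apply/eqP; rewrite -(eqr_nat rat) !natrM -nq -(qE i) -mulrA divfK.
have full i L : L \in U ord0 -> missing i L = 0.
  move=> LU; have [j ij] : exists j, i != j.
    have [->|i0] := eqVneq i ord0; last by exists ord0.
    by exists ord_max; rewrite -val_eqE /= eq_sym -lt0n.
  by apply: (cover_tight j); rewrite ?(tight j).2 // (UE j ord0).
have intU : {in U ord0 &, forall A B : {set 'I_n}, ~~ [disjoint A & B]}.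
  move=> A B AU BU; apply/negP => dAB.
  have cA : #|A| = l by have := subsetP (uncovered_sub _ _) _ AU; rewrite inE => /andP[_ /eqP].
  have cB : #|B| = l by have := subsetP (uncovered_sub _ _) _ BU; rewrite inE => /andP[_ /eqP].
  have cAB : #|~: (A :|: B)| = n - (l + l).
    rewrite cardsCs setCK card_ord cardsU cA cB.
    by move: dAB; rewrite -setI_eq0 => /eqP ->; rewrite cards0 subn0.
  have /card_gt0P[C] : 0 < #|[set C : {set 'I_n} | C \subset ~: (A :|: B) & #|C| == k - l]|.
    by rewrite cards_draws cAB bin_gt0; lia.
  rewrite inE => /andP[sC /eqP cC].
  have dC : [disjoint C & A :|: B] by rewrite disjoints_subset.
  have dBC : B :&: C = set0.
    by apply/eqP; rewrite setI_eq0 disjoint_sym (disjointWr (subsetUr A B) dC).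
  have /eqP := full ord0 A AU; rewrite /missing cards_eq0 => /eqP/setP/(_ (B :|: C)).
  rewrite !inE cardsU dBC cards0 subn0 cB cC subnKC // eqxx /=.
  have -> : [disjoint A & B :|: C].
    rewrite disjoint_sym disjoints_subset subUset -!disjoints_subset.
    by rewrite disjoint_sym dAB /= (disjointWr (subsetUl A B) dC).
  have -> // : B :|: C \notin F ord0.
  apply: contraTN isT => BCF; move: BU; rewrite inE => /andP[_ /forall_inP/(_ _ BCF)].
  by rewrite subsetUl.
have l2 : 2 * l < #|'I_n| by rewrite card_ord; lia.
have cU' : #|'I_n| * #|U ord0| = l * 'C(#|'I_n|, l) by rewrite card_ord.
have [y Uy] := intersecting_max_star _ (U ord0) l l_gt0 l2 (uncovered_sub _ _) intU cU'.
exists y => i; apply/eqP; rewrite eqEcard; apply/andP; split.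
  apply/subsetP => A AF; have := subsetP (F_sub i) _ AF; rewrite !inE => /andP[_ /eqP cA].
  rewrite cA eqxx andbT subsetD1 subsetT /=; apply/negP => yA.
  have /card_gt0P[C] : 0 < #|[set C : {set 'I_n} | C \subset A :\ y & #|C| == l.-1]|.
    by rewrite cards_draws bin_gt0; have := cardsD1 y A; rewrite yA cA; lia.
  rewrite inE => /andP[sC /eqP cC].
  have yC : y \notin C by apply: contraTN sC => yC; apply/subsetPn; exists y; rewrite ?inE ?eqxx.
  have : y |: C \in U i.
    by rewrite (UE i ord0) Uy !inE subsetT cardsU1 yC cC add1n prednK // !eqxx.
  rewrite inE => /andP[_ /forall_inP/(_ _ AF)].
  by rewrite subUset sub1set yA (subset_trans sC) // subD1set.
have n_gt0 : 0 < n by lia.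
rewrite cards_draws setTD cardsC1 card_ord -(leq_pmul2l n_gt0) mul_bin_down.
by rewrite mulnBl -(cm i) -(cardF i) mulnDr addnK.
Qed.

End CrossUnion.

Local Open Scope ring_scope.

(** * The bound and its equality case *)

Theorem theorem1p5 (n k s l : nat) (F : 'I_s.+1 -> {set {set 'I_n}})
    (n_gt0 : (0 < n)%N) (k_gt0 : (0 < k)%N) (s_gt0 : (0 < s)%N)
    (l_gt0 : (1 <= l)%N) (l_le_k : (l <= k)%N)
    (n_eq : n = (s * k + l)%N) (s_ge : (4 * l <= s)%N)
    (F_sub : forall i, F i \subset ksubsets [set: 'I_n] k)
    (F_neq0 : forall i, F i != set0)
    (F_cross : cross_union F) :
  (\sum_i #|F i|)%N%:R / s.+1%:R <= 'C(n - 1, k)%:R :> rat /\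
  ((\sum_i #|F i|)%N%:R / s.+1%:R = 'C(n - 1, k)%:R :> rat ->
   exists x : 'I_n, forall i, F i = ksubsets ([set: 'I_n] :\ x) k).
Proof.
pose N : rat := 'C(n, k)%:R.
pose Q : rat := \sum_i (#|ksubsets [set: 'I_n] k :\: F i|%:R / N).
have k_lt_n : (k < n)%N by rewrite n_eq; nia.
have N0 : 0 < N by rewrite ltr0n bin_gt0 ltnW.
have n0 : 0 < n%:R :> rat by rewrite ltr0n.
have s0 : 0 < s.+1%:R :> rat by rewrite ltr0n.
have sumF : (\sum_i #|F i|)%N%:R = (s.+1%:R - Q) * N.
  rewrite mulrBl mulr_suml natr_sum.
  under [X in _ = _ - X]eq_bigr do rewrite divfK ?gt_eqF //.
  have -> : s.+1%:R * N = \sum_(i < s.+1) N by rewrite sumr_const card_ord mulr_natl.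
  rewrite -sumrB; apply: eq_bigr => i _.
  have <- : (#|F i| + #|ksubsets [set: 'I_n] k :\: F i|)%N%:R = N.
    by rewrite cardsC_ksubsets ?card_ord.
  by rewrite natrD addrK.
have binE : n%:R * 'C(n - 1, k)%:R = (n%:R - k%:R) * N :> rat.
  by rewrite -natrM subn1 mul_bin_down natrM natrB // ltnW.
have gapE : n%:R * (s.+1%:R * 'C(n - 1, k)%:R - (\sum_i #|F i|)%N%:R)
    = N * (n%:R * Q - (s.+1 * k)%:R).
  by rewrite sumF natrM mulrBr mulrCA binE; ring.
split.
  rewrite ler_pdivrMr // mulrC -subr_ge0 -(pmulr_rge0 _ n0) gapE.
  rewrite pmulr_rge0 // subr_ge0.
  by have [] := cross_union_deficiency l_gt0 l_le_k n_eq s_ge F_sub F_neq0 F_cross.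
move=> eqF; apply: (cross_union_extremal l_gt0 l_le_k n_eq s_ge F_sub F_neq0 F_cross).
have : N * (n%:R * Q - (s.+1 * k)%:R) = 0.
  by rewrite -gapE -eqF mulrCA mulfV ?gt_eqF // mulr1 subrr mulr0.
by move/eqP; rewrite mulf_eq0 gt_eqF //= subr_eq0 => /eqP.
Qed.
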